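(* Let $R$ be a ring, $M$ a Tate $R$-module and $T:M\to M$ a topologically nilpotent automorphism (of Tate modules). Equip $M$ with the topological $R((t))$-module structure such that $tm=T(m)$ for $m\in M$. Then $M$ is a finitely generated projective $R((t))$-module, and the topology of $M$ is its standard topology.
   Context: Tate $R$-module: topological direct summand of $P\oplus Q^*$ with $P,Q$ discrete projective $R$-modules and $Q^*=\operatorname{Hom}_R(Q,R)$ with topology of pointwise convergence. A lattice in $M$ is an open submodule $L$ with $L/U$ finitely generated for every open submodule $U\subset L$. An endomorphism $T$ of $M$ is topologically nilpotent if for all lattices $L,L'\subset M$ there exists $N$ with $T^nL'\subset L$ for all $n>N$ (equivalently, there is a structure of topological $R[[t]]$-module on $M$ with $t$ acting as $T$). The standard topology on a finitely generated projective $R((t))$-module $N$ is the unique topological $R((t))$-module structure such that every $R((t))$-linear map $N\to R((t))$ is continuous, $R((t))$ having the topology with basis $t^nR[[t]]$. *)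

(* Defs.v *)
From mathcomp Require Import all_boot all_order all_algebra.
Set Implicit Arguments. Unset Strict Implicit. Unset Printing Implicit Defensive.
Import GRing.Theory Num.Theory.
Local Open Scope ring_scope.

Definition is_topology (T : Type) (op : (T -> Prop) -> Prop) : Prop :=
  op (fun _ => True) /\
  (forall U V, op U -> op V -> op (fun x => U x /\ V x)) /\
  (forall F : (T -> Prop) -> Prop, (forall U, F U -> op U) ->
     op (fun x => exists U, F U /\ U x)).

Definition continuous_for (A B : Type) (opA : (A -> Prop) -> Prop)
  (opB : (B -> Prop) -> Prop) (f : A -> B) : Prop :=
  forall V, opB V -> opA (fun x => V (f x)).

Definition prod_open (A B : Type) (opA : (A -> Prop) -> Prop)
  (opB : (B -> Prop) -> Prop) (W : A * B -> Prop) : Prop :=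
  forall a b, W (a, b) -> exists U V, opA U /\ opB V /\ U a /\ V b /\
    (forall a' b', U a' -> V b' -> W (a', b')).

Section Tate.
Variable R : comPzRingType.

Definition projective_mod (P : lmodType R) : Prop :=
  forall (A B : lmodType R) (f : {linear A -> B}) (g : {linear P -> B}),
    (forall b, exists a, f a = b) ->
    exists h : {linear P -> A}, forall x, f (h x) = g x.

Definition lin_form (Q : lmodType R) (f : Q -> R) : Prop :=
  forall (a : R) (x y : Q), f (a *: x + y) = a * f x + f y.

Definition dual (Q : lmodType R) := {f : Q -> R | lin_form f}.

(** topology on P (+) Q^*, P discrete, Q^* with the topology of pointwise
    convergence (R discrete) *)
Definition PQ_open (P Q : lmodType R) (W : P * dual Q -> Prop) : Prop :=
  forall x phi, W (x, phi) -> exists qs : seq Q,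
    forall psi : dual Q, (forall q, q \in qs -> sval psi q = sval phi q) ->
      W (x, psi).

(** ** Tate R-modules: topological direct summands of P (+) Q^* *)
Definition tate_module (M : lmodType R) (opM : (M -> Prop) -> Prop) : Prop :=
  is_topology opM /\
  exists (P Q : lmodType R), projective_mod P /\ projective_mod Q /\
  exists (i1 : M -> P) (i2 : M -> dual Q) (p : P * dual Q -> M),
    (forall (a : R) m m', i1 (a *: m + m') = a *: i1 m + i1 m') /\
    (forall (a : R) m m' q,
        sval (i2 (a *: m + m')) q = a * sval (i2 m) q + sval (i2 m') q) /\
    (forall (a : R) x x' (phi phi' chi : dual Q),
        (forall q, sval chi q = a * sval phi q + sval phi' q) ->
        p (a *: x + x', chi) = a *: p (x, phi) + p (x', phi')) /\
    continuous_for opM (@PQ_open P Q) (fun m => (i1 m, i2 m)) /\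
    continuous_for (@PQ_open P Q) opM p /\
    (forall m, p (i1 m, i2 m) = m).

Definition lin_map (M N : lmodType R) (f : M -> N) : Prop :=
  forall (a : R) x y, f (a *: x + y) = a *: f x + f y.

Definition tate_automorphism (M : lmodType R) (opM : (M -> Prop) -> Prop)
  (T : M -> M) : Prop :=
  lin_map T /\ continuous_for opM opM T /\
  exists Tinv : M -> M, lin_map Tinv /\ continuous_for opM opM Tinv /\
    (forall m, T (Tinv m) = m) /\ (forall m, Tinv (T m) = m).

Definition submod (M : lmodType R) (L : M -> Prop) : Prop :=
  L 0 /\ (forall (a : R) x y, L x -> L y -> L (a *: x + y)).

Definition lattice (M : lmodType R) (opM : (M -> Prop) -> Prop)
  (L : M -> Prop) : Prop :=
  submod L /\ opM L /\
  forall U : M -> Prop, submod U -> opM U -> (forall x, U x -> L x) ->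
    (* L / U is finitely generated *)
    exists xs : seq M, (forall x, x \in xs -> L x) /\
      forall y, L y -> exists c : 'I_(size xs) -> R,
        U (y - \sum_(k < size xs) c k *: nth 0 xs k).

Definition top_nilpotent (M : lmodType R) (opM : (M -> Prop) -> Prop)
  (T : M -> M) : Prop :=
  forall L L', lattice opM L -> lattice opM L' ->
    exists N : nat, forall n : nat, (N < n)%N ->
      forall x, L' x -> L (iter n T x).

Definition lbound (f : int -> R) (a : int) : Prop :=
  forall k : int, k < a -> f k = 0.

Definition lseries := {f : int -> R | exists a : int, lbound f a}.

(** coefficient n of the product, computed with lower bounds a of f, b of g *)
Definition conv_win (f g : int -> R) (a b n : int) : R :=
  if (n - a - b < 0)%R then 0
  else \sum_(k < (absz (n - a - b)%R).+1) f (a + k%:Z) * g (n - a - k%:Z).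

Definition is_lmul (f g h : int -> R) : Prop :=
  forall a b, lbound f a -> lbound g b -> forall n, h n = conv_win f g a b n.

(** topology on R((t)) with basis t^n R[[t]] (translates) *)
Definition lopen (U : lseries -> Prop) : Prop :=
  forall f, U f -> exists n : int,
    forall g : lseries, (forall k, k < n -> sval g k = sval f k) -> U g.

Definition lt_structure (M : lmodType R) (opM : (M -> Prop) -> Prop)
  (T : M -> M) (s : lseries -> M -> M) : Prop :=
  (forall f g h m, (forall n, sval h n = sval f n + sval g n) ->
      s h m = s f m + s g m) /\
  (forall f m m', s f (m + m') = s f m + s f m') /\
  (forall f g h m, is_lmul (sval f) (sval g) (sval h) ->
      s h m = s f (s g m)) /\
  (* constants r \in R act through the given R-module structure (so 1 acts as id) *)
  (forall (r : R) f m, (forall n, sval f n = if n == 0 then r else 0) ->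
      s f m = r *: m) /\
  (forall f m, (forall n, sval f n = if n == 1 then 1 else 0) -> s f m = T m) /\
  continuous_for (prod_open lopen opM) opM (fun fm => s fm.1 fm.2).

Definition fg_projective (M : lmodType R) (s : lseries -> M -> M) : Prop :=
  exists (N : nat) (i : M -> 'I_N -> lseries) (p : ('I_N -> lseries) -> M),
    (forall m m' k n, sval (i (m + m') k) n = sval (i m k) n + sval (i m' k) n) /\
    (forall f m k, is_lmul (sval f) (sval (i m k)) (sval (i (s f m) k))) /\
    (forall u v w, (forall k n, sval (u k) n = sval (v k) n + sval (w k) n) ->
        p u = p v + p w) /\
    (forall f v u, (forall k, is_lmul (sval f) (sval (v k)) (sval (u k))) ->
        p u = s f (p v)) /\
    (forall m, p (i m) = m).

(** ** The topology of M is the standard one: every R((t))-linear map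
    M -> R((t)) is continuous (M being a topological R((t))-module) *)
Definition standard_topology (M : lmodType R) (opM : (M -> Prop) -> Prop)
  (s : lseries -> M -> M) : Prop :=
  forall phi : M -> lseries,
    (forall m m' n, sval (phi (m + m')) n = sval (phi m) n + sval (phi m') n) ->
    (forall f m, is_lmul (sval f) (sval (phi m)) (sval (phi (s f m)))) ->
    continuous_for opM lopen phi.

End Tate.

(* Main.v *)
From HB Require Import structures.
From mathcomp Require Import all_boot all_order all_algebra.
From mathcomp Require Import boolp zify.
Require Import Defs.
Set Implicit Arguments. Unset Strict Implicit. Unset Printing Implicit Defensive.
Import Order.TTheory GRing.Theory Num.Theory.
Local Open Scope ring_scope.

(** Dual bases of [P] and [Q] present [M] as a retract of the sum of a free module
    and a product [B -> R].  The image of the product is a lattice; the sum [L] of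
    finitely many of its translates under [T] is a [T]-stable lattice, and the
    submodules [Lam n = T^n L] form a basis of neighbourhoods of [0].  Hence the
    action of a Laurent series [f] on [m] can only be the limit of the partial sums
    of [\sum_k f_k T^k m], which exists because [M] is complete and separated.

    Let [th] be the retraction of [M] onto the image of the product.  It has values
    in [L] and is the identity near [0], so [T^n th T^-n] tends to [0] for
    [n -> +oo] and to the identity for [n -> -oo].  With [beta = th - T th T^-1]
    this telescopes to [m = \sum_n T^n (beta (T^-n m))].  As [beta] has values in
    [L] and kills an open submodule, lifting it to expansions along generators
    [u k] of [L] modulo [T L] and regrouping powers of [T] gives continuous
    [R]-linear forms [lam k] with [m = \sum_k (\sum_n lam k (T^-n m) t^n) u k]: a
    finite dual basis of [M] over [R((t))], with continuous coordinates. *)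

(** * Finite sums and common bounds *)

Lemma sum_triangle (V : zmodType) (F : nat -> nat -> V) k :
  \sum_(n < k) \sum_(i < n.+1) F i (n - i)%N =
  \sum_(i < k) \sum_(l < k - i) F i l.
Proof.
elim: k => [|k IHk]; first by rewrite !big_ord0.
rewrite big_ord_recr /= IHk.
transitivity (\sum_(i < k.+1) (\sum_(l < k - i) F i l + F i (k - i)%N)).
  rewrite big_split /=; congr (_ + _).
  by rewrite [RHS]big_ord_recr /= subnn big_ord0 addr0.
by apply: eq_bigr => i _; rewrite subSn ?big_ord_recr // -ltnS.
Qed.

Lemma big_uniq_supp (V : nmodType) (X : eqType) (s s' : seq X) (F : X -> V) :
  uniq s -> uniq s' -> (forall x, x \notin s -> F x = 0) ->
  (forall x, x \notin s' -> F x = 0) ->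
  \sum_(x <- s) F x = \sum_(x <- s') F x.
Proof.
move=> us us' F0 F0'.
rewrite (bigID (fun x => x \in s')) [RHS](bigID (fun x => x \in s)) /=.
rewrite [X in _ + X = _]big1 // [X in _ = _ + X]big1 // !addr0.
rewrite -[LHS]big_filter -[RHS]big_filter; apply: perm_big.
apply: uniq_perm; rewrite ?filter_uniq // => x.
by rewrite !mem_filter andbC.
Qed.

(** Minus the sum of the absolute values of the finitely many bounds lies below each of them. *)
Lemma common_lower_bound r (P : 'I_r -> int -> Prop) :
  (forall k a a', a' <= a -> P k a -> P k a') -> (forall k, exists a, P k a) ->
  exists a, forall k, P k a.
Proof.
move=> Ple /choice[c Pc]; exists (- (\sum_k absz (c k))%N%:Z) => k.
apply: Ple (Pc k); rewrite (bigD1 k) //=; lia.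
Qed.

(** * Laurent series: products, monomials, truncations *)

Section LaurentSeries.
Variable R : comPzRingType.
Implicit Types f g h : int -> R.

Lemma lbound_le f a a' : a' <= a -> lbound f a -> lbound f a'.
Proof. by move=> le_a fa k lt_k; apply: fa; apply: lt_le_trans le_a. Qed.

(** [g] vanishes below [b], so the terms past the window are zero and any large enough length [K]
    will do; products computed with different bounds thus become comparable. *)
Lemma conv_winE f g a b n K : lbound g b -> n - a - b < K%:Z ->
  conv_win f g a b n = \sum_(k < K) f (a + k%:Z) * g (n - a - k%:Z).
Proof.
move=> gb ltK; rewrite /conv_win; case: ifP => [lt0 | ge0].
  rewrite big1 // => k _; rewrite (gb (n - a - k%:Z)) ?mulr0 //; lia.
set m := (X in X.+1).
have -> : K = (m.+1 + (K - m.+1))%N by rewrite /m; lia.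
rewrite big_split_ord /= [X in _ = _ + X]big1 ?addr0 // => k _.
rewrite (gb (n - a - _)) ?mulr0 //=; rewrite /m; lia.
Qed.

Lemma conv_win_le f g a b a' b' n : a' <= a -> lbound f a -> lbound g b ->
  lbound g b' -> conv_win f g a b n = conv_win f g a' b' n.
Proof.
move=> le_a fa gb gb'.
have [d ad] : exists d : nat, a = a' + d%:Z by exists (absz (a - a')%R); lia.
rewrite {}ad in fa *.
set K := (absz (n - a' - b)%R + absz (n - a' - b')%R).+1%N.
rewrite (@conv_winE f g (a' + d%:Z) b n K) //; last by rewrite /K; lia.
rewrite (@conv_winE f g a' b' n (d + K)) //; last by rewrite /K; lia.
rewrite big_split_ord /= [X in _ = X + _]big1 ?add0r => [|k _].
  apply: eq_bigr => k _; rewrite PoszD; congr (f _ * g _); lia.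
rewrite fa ?mul0r //; have := ltn_ord k; lia.
Qed.

(** Any two lower bounds of [f] are comparable, so [conv_win_le] carries the formula from one pair
    of bounds to every other. *)
Lemma is_lmul_at f g h a b : lbound f a -> lbound g b ->
  (forall n, h n = conv_win f g a b n) -> is_lmul f g h.
Proof.
move=> fa gb hE a' b' fa' gb' n; rewrite hE.
have [le_a | /ltW le_a] := leP a' a; first exact: conv_win_le.
by symmetry; apply: conv_win_le.
Qed.

Definition mk_lseries f a (fa : lbound f a) : lseries R :=
  exist (fun f => exists a, lbound f a) f (ex_intro _ a fa).

Definition mono (r : R) (i : int) : int -> R := fun n => if n == i then r else 0.

Lemma mono_lbound r i : lbound (mono r i) i.
Proof. by move=> k; rewrite /mono; case: eqP => // ->; rewrite ltxx. Qed.

Definition lmono (r : R) (i : int) : lseries R := mk_lseries (@mono_lbound r i).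

Lemma mono_mul r r' i i' :
  is_lmul (mono r i) (mono r' i') (mono (r * r') (i + i')).
Proof.
apply: (is_lmul_at (@mono_lbound r i) (@mono_lbound r' i')) => n.
rewrite /conv_win /mono; case: ltP => [lt0 | ge0].
  by case: eqP => // ?; lia.
rewrite big_ord_recl /= [X in _ = _ + X]big1 => [|k _]; last first.
  by case: eqP => [|_]; rewrite ?mul0r //= /bump; lia.
rewrite !addr0 eqxx.
have -> : (n - i == i') = (n == i + i') by apply/eqP/eqP; lia.
by case: ifP; rewrite ?mulr0.
Qed.

Lemma lbound_mul f g h a b : lbound f a -> lbound g b -> is_lmul f g h ->
  lbound h (a + b).
Proof.
move=> fa gb mul n lt_n; rewrite (mul _ _ fa gb) /conv_win.
by have -> : n - a - b < 0 by lia.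
Qed.

Lemma lseries_trunc (f : lseries R) (n : int) : exists f1 f2 : lseries R,
  [/\ forall k, sval f1 k = if k < n then sval f k else 0,
      forall k, sval f2 k = if k < n then 0 else sval f k
    & forall k, sval f k = sval f1 k + sval f2 k].
Proof.
case: f => f /= [a fa].
have b1 : lbound (fun k => if k < n then f k else 0) a.
  by move=> k ltk; case: ifP => // _; apply: fa.
have b2 : lbound (fun k => if k < n then 0 else f k) a.
  by move=> k ltk; case: ifP => // _; apply: fa.
exists (mk_lseries b1), (mk_lseries b2).
by split => //= k; case: ifP; rewrite ?addr0 ?add0r.
Qed.

End LaurentSeries.

(** * Closure properties of submodules *)

Section Submodules.
Variables (R : comPzRingType) (M : lmodType R) (L : M -> Prop).
Hypothesis subL : submod L.

Lemma submod0 : L 0. Proof. by case: subL. Qed.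
Lemma submodZ a x : L x -> L (a *: x).
Proof. by move=> Lx; rewrite -[_ *: _]addr0; apply subL => //; apply: submod0. Qed.
Lemma submodD x y : L x -> L y -> L (x + y).
Proof. by move=> Lx Ly; rewrite -[x]scale1r; apply subL. Qed.
Lemma submodN x : L x -> L (- x).
Proof. by move=> Lx; rewrite -scaleN1r; apply: submodZ. Qed.
Lemma submodB x y : L x -> L y -> L (x - y).
Proof. by move=> Lx Ly; apply: submodD => //; apply: submodN. Qed.
Lemma submod_sum I (r : seq I) (P : pred I) (F : I -> M) :
  (forall i, P i -> L (F i)) -> L (\sum_(i <- r | P i) F i).
Proof. by move=> LF; apply: big_ind => //; [apply: submod0 | apply: submodD]. Qed.

End Submodules.

(** * Integer powers of [T] and the filtration of [M] by [T^n L] *)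

Section Powers.
Variables (R : comPzRingType) (M : lmodType R) (T Ti : {linear M -> M}).

Definition pw (n : int) : M -> M :=
  match n with Posz n => iter n T | Negz n => iter n.+1 Ti end.

Lemma pw_linear n : linear (pw n).
Proof.
move=> a x y; case: n => n; rewrite /pw.
  by elim: n => //= n ->; rewrite linearP.
by elim: n.+1 => //= k ->; rewrite linearP.
Qed.

HB.instance Definition _ n := GRing.isLinear.Build R M M _ (pw n) (pw_linear n).

Hypotheses (TK : cancel T Ti) (TiK : cancel Ti T).

Lemma pwS n x : pw (n + 1) x = T (pw n x).
Proof.
case: n => [n | [|n]]; first by rewrite addrC -intS.
  by rewrite /= TiK.
have -> : Negz n.+1 + 1 = Negz n by lia.
by rewrite /= TiK.
Qed.

Arguments pw : simpl never.

Lemma pwP n x : pw (n - 1) x = Ti (pw n x).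
Proof. by rewrite -{2}[n](subrK 1) pwS TK. Qed.

Lemma pwD m n x : pw (m + n) x = pw m (pw n x).
Proof.
elim/int_rect: m => [|m IHm|m IHm]; first by rewrite add0r.
  by rewrite intS [1 + _]addrC pwS -IHm -pwS addrAC.
have -> : - m.+1%:Z = - m%:Z - 1 by lia.
by rewrite pwP -IHm -pwP addrAC.
Qed.

Lemma pwK n : cancel (pw n) (pw (- n)).
Proof. by move=> x; rewrite -pwD addNr. Qed.

Lemma pwNK n : cancel (pw (- n)) (pw n).
Proof. by move=> x; rewrite -pwD subrr. Qed.

Variables (L : M -> Prop).
Hypotheses (subL : submod L) (LT : forall x, L x -> L (T x)).

(** The submodule [T^n L], written as a preimage under [T^-n] so that membership carries no
    existential; it decreases with [n] because [T] maps [L] into itself. *)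
Definition Lam (n : int) (m : M) : Prop := L (pw (- n) m).

Lemma Lam_submod n : submod (Lam n).
Proof.
split=> [|a x y]; rewrite /Lam ?linear0 ?linearP; first exact: submod0.
by case: subL => _; apply.
Qed.

Lemma Lam0 m : Lam 0 m = L m. Proof. by rewrite /Lam oppr0. Qed.

Lemma Lam_pw n k m : Lam (k + n) (pw k m) = Lam n m.
Proof. by rewrite /Lam -pwD; congr (L (pw _ _)); lia. Qed.

Lemma Lam_le n n' m : n <= n' -> Lam n' m -> Lam n m.
Proof.
move=> le_n Lm; have [d nE] : exists d : nat, n' = n + d%:Z.
  by exists (absz (n' - n)%R); lia.
rewrite /Lam; have -> : - n = d%:Z - n' by lia.
rewrite pwD; elim: d {nE} => //= d IHd; exact: LT.
Qed.

Hypothesis Labs : forall m, exists n : nat, L (iter n T m).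

Lemma Lam_absorb m : exists n, Lam n m.
Proof. by have [n Ln] := Labs m; exists (- n%:Z); rewrite /Lam opprK. Qed.

(** * Limits of the partial sums of a Laurent series in [T] *)

Definition psum (f : int -> R) (a : int) (k : nat) (m : M) : M :=
  \sum_(i < k) f (a + i%:Z) *: pw (a + i%:Z) m.

(** Each further term is a multiple of some [T^i m] with [i >= a + k], and these lie in
    [T^(a+c+k) L]. *)
Lemma psum_tail f a c k k' m : Lam c m -> (k <= k')%N ->
  Lam (a + c + k%:Z) (psum f a k' m - psum f a k m).
Proof.
move=> Lm /subnKC<-; rewrite /psum big_split_ord /= [X in Lam _ X]addrC addKr.
have sub := Lam_submod (a + c + k).
apply: submod_sum => // i _; apply: submodZ => //.
apply: (@Lam_le _ ((a + (k + i)%N%:Z) + c)); first by lia.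
by rewrite Lam_pw.
Qed.

Lemma psum_shift f a (d k : nat) m : lbound f (a + d%:Z) ->
  psum f a (d + k) m = psum f (a + d%:Z) k m.
Proof.
move=> fa; rewrite /psum big_split_ord /= big1 ?add0r => [|i _].
  by apply: eq_bigr => i _; rewrite PoszD addrA.
rewrite fa ?scale0r //; have := ltn_ord i; lia.
Qed.

Lemma psumD f a k x y : psum f a k (x + y) = psum f a k x + psum f a k y.
Proof. by rewrite -big_split; apply: eq_bigr => i _; rewrite linearD scalerDr. Qed.

(* [m'] is the limit of the partial sums of [\sum_k f_k T^k m]. *)
Definition is_act (f : int -> R) (m m' : M) : Prop :=
  forall a, lbound f a -> forall N, exists K : nat, forall k, (K <= k)%N ->
    Lam N (m' - psum f a k m).

(** Lowering the bound by [d] only prepends [d] zero terms, which shifts the index of the partial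
    sums. *)
Lemma is_act_at f m m' a : lbound f a ->
  (forall N, exists K : nat, forall k, (K <= k)%N -> Lam N (m' - psum f a k m)) ->
  is_act f m m'.
Proof.
move=> fa H a' fa' N; have [K HK] := H N.
have [le_a | /ltW le_a] := leP a' a.
  have [d ad] : exists d : nat, a = a' + d%:Z by exists (absz (a - a')%R); lia.
  rewrite {}ad in fa HK; exists (d + K)%N => k lek.
  have -> : k = (d + (k - d))%N by lia.
  by rewrite psum_shift //; apply: HK; lia.
have [d ad] : exists d : nat, a' = a + d%:Z by exists (absz (a - a')%R); lia.
rewrite {}ad in fa' *; exists K => k lek.
by rewrite -psum_shift //; apply: HK; lia.
Qed.

(** A partial sum long enough to be close to [m'] differs from the [k]-th one by the tail bound, so
    the error is explicit in [a], [c] and [k]. *)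
Lemma is_act_exact f m m' a c (k : nat) : lbound f a -> is_act f m m' ->
  Lam c m -> Lam (a + c + k%:Z) (m' - psum f a k m).
Proof.
move=> fa act Lm; have [K HK] := act _ fa (a + c + k%:Z).
have sub := Lam_submod (a + c + k%:Z).
have Hk := HK (maxn K k) (leq_maxl _ _).
have := submodD sub Hk (psum_tail f a Lm (leq_maxr K k)).
by rewrite addrA subrK.
Qed.

Lemma is_act_Lam f m m' a c : lbound f a -> is_act f m m' ->
  Lam c m -> Lam (a + c) m'.
Proof.
move=> fa act Lm; have := is_act_exact 0 fa act Lm.
by rewrite /psum big_ord0 addr0 subr0.
Qed.

Hypothesis Lsep : forall m, (forall n, Lam n m) -> m = 0.

Lemma is_act_uniq f m m1 m2 : (exists a, lbound f a) ->
  is_act f m m1 -> is_act f m m2 -> m1 = m2.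
Proof.
case=> a fa act1 act2; apply/subr0_eq/Lsep => N.
have [[K1 H1] [K2 H2]] := (act1 _ fa N, act2 _ fa N).
have sub := Lam_submod N.
have := submodB sub (H1 _ (leq_maxl K1 K2)) (H2 _ (leq_maxr K1 K2)).
by rewrite opprB addrA subrK.
Qed.

Lemma is_actD f m m' n n' : is_act f m m' -> is_act f n n' ->
  is_act f (m + n) (m' + n').
Proof.
move=> act1 act2 a fa N.
have [[K1 H1] [K2 H2]] := (act1 _ fa N, act2 _ fa N).
exists (maxn K1 K2) => k; rewrite geq_max => /andP[le1 le2].
have := submodD (Lam_submod N) (H1 _ le1) (H2 _ le2).
by rewrite psumD opprD addrACA.
Qed.

Lemma is_act_add f g h m m' m'' : (exists a, lbound f a) ->
  (exists b, lbound g b) -> (forall n, h n = f n + g n) ->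
  is_act f m m' -> is_act g m m'' -> is_act h m (m' + m'').
Proof.
move=> [a fa] [b gb] hE act1 act2.
have le1 : Order.min a b <= a by rewrite ge_min lexx.
have le2 : Order.min a b <= b by rewrite ge_min lexx orbT.
have {}fa := lbound_le le1 fa; have {}gb := lbound_le le2 gb.
have hc : lbound h (Order.min a b) by move=> k ltk; rewrite hE fa ?gb ?addr0.
apply: (is_act_at hc) => N.
have [[K1 H1] [K2 H2]] := (act1 _ fa N, act2 _ gb N).
exists (maxn K1 K2) => k; rewrite geq_max => /andP[{}le1 {}le2].
have := submodD (Lam_submod N) (H1 _ le1) (H2 _ le2).
rewrite addrACA -opprD -big_split /=; congr (Lam N (_ - _)).
by apply: eq_bigr => i _; rewrite hE scalerDl.
Qed.

Lemma is_act_mono r i f m : (forall n, f n = mono r i n) ->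
  is_act f m (r *: pw i m).
Proof.
move=> fE; have fi : lbound f i by move=> k /(@mono_lbound _ r); rewrite fE.
apply: (is_act_at fi) => N; exists 1%N => -[//|k] _.
rewrite /psum big_ord_recl big1 => [|j _]; last first.
  by rewrite fE /mono; case: eqP => [|_]; rewrite ?scale0r //= /bump; lia.
by rewrite !addr0 fE /mono eqxx subrr; apply: submod0; apply: Lam_submod.
Qed.

(** Composing the partial sums of [f] and [g] gives a sum over a square of indices, the Cauchy
    product a sum over a triangle; the terms in between have degree at least [a + b + k] and are
    negligible. *)
Lemma is_act_mul f g h m m' m'' : (exists a, lbound f a) ->
  (exists b, lbound g b) -> is_lmul f g h ->
  is_act g m m' -> is_act f m' m'' -> is_act h m m''.
Proof.
move=> [a fa] [b gb] mul actg actf.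
have hab := lbound_mul fa gb mul.
have [c Lm] := Lam_absorb m.
have Lm' := is_act_Lam gb actg Lm.
apply: (is_act_at hab) => N.
exists (absz (N - a - b - c)%R) => k lek.
apply: (@Lam_le _ (a + (b + c) + k%:Z)); first by lia.
have sub := Lam_submod (a + (b + c) + k%:Z).
have Hf := is_act_exact k fa actf Lm'.
(* The error of the partial sum for [g] stays small after each power of [T] occurring in the sum for
   [f]. *)
have Hg : Lam (a + (b + c) + k%:Z) (psum f a k (m' - psum g b k m)).
  apply: submod_sum => // i _; apply: submodZ => //.
  apply: (@Lam_le _ ((a + i%:Z) + (b + c + k%:Z))); first by lia.
  by rewrite Lam_pw; apply: is_act_exact.
have Hk := submodD sub Hf Hg.
pose F i l := (f (a + i%:Z) * g (b + l%:Z)) *: pw (a + i%:Z + (b + l%:Z)) m.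
have E1 : psum f a k m' - psum f a k (m' - psum g b k m) =
          \sum_(i < k) \sum_(l < k) F i l.
  rewrite -sumrB; apply: eq_bigr => i _.
  rewrite -scalerBr -linearB opprB addrCA subrr addr0 linear_sum scaler_sumr.
  by apply: eq_bigr => l _; rewrite linearZ /= -pwD scalerA.
have E2 : psum h (a + b) k m = \sum_(i < k) \sum_(l < k - i) F i l.
  rewrite -sum_triangle; apply: eq_bigr => n _.
  rewrite (mul _ _ fa gb) (@conv_winE _ f g a b _ n.+1 gb); last by lia.
  rewrite scaler_suml; apply: eq_bigr => i _.
  have := ltn_ord i; rewrite ltnS => lei; rewrite /F.
  congr ((_ * g _) *: pw _ m); lia.
have E3 : Lam (a + (b + c) + k%:Z)
   (\sum_(i < k) \sum_(l < k) F i l - \sum_(i < k) \sum_(l < k - i) F i l).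
  rewrite -sumrB; apply: submod_sum => // i _.
  have -> : \sum_(l < k) F i l = \sum_(l < k - i + i) F i l.
    by rewrite subnK // ltnW.
  rewrite big_split_ord /= [X in Lam _ X]addrC addKr.
  apply: submod_sum => // l _; apply: submodZ => //.
  apply: (@Lam_le _ ((a + i%:Z + (b + (k - i + l)%N%:Z)) + c)).
    by have := ltn_ord i; lia.
  by rewrite Lam_pw.
have := submodD sub Hk E3; rewrite -E2 -E1.
congr (Lam _ _); rewrite addrA; congr (_ - _).
by rewrite -addrA [X in _ + X]addrC !subrK.
Qed.

Hypothesis Lcomplete : forall v : nat -> M, (forall i, L (v i)) ->
  exists m, forall n : nat, Lam n%:Z (m - \sum_(i < n) pw i%:Z (v i)).

(** [Lcomplete] sums the [T^i v_i] with [v_i] in [L]; taking [v_i = f_(a+i) T^-c m] brings the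
    series to this form, and [T^(a+c)] carries the limit back. *)
Lemma is_act_ex f m : (exists a, lbound f a) -> exists m', is_act f m m'.
Proof.
case=> a fa; have [c Lm] := Lam_absorb m.
have Lv i : L (f (a + i%:Z) *: pw (- c) m) by apply: submodZ.
have [m' Hm'] := Lcomplete (v := fun i => f (a + i%:Z) *: pw (- c) m) Lv.
exists (pw (a + c) m'); apply: (is_act_at fa) => N.
exists (absz (N - a - c)%R) => k lek.
apply: (@Lam_le _ (a + c + k%:Z)); first by lia.
have := Hm' k; rewrite -(Lam_pw _ (a + c)) linearB linear_sum /=.
congr (Lam _ (_ - _)); apply: eq_bigr => i _.
rewrite !linearZ /= -!pwD; congr (_ *: pw _ _); lia.
Qed.

(** * Existence and uniqueness of the topological [R((t))]-module structure *)

Variable opM : (M -> Prop) -> Prop.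
Hypothesis Ltop : forall W, opM W <->
  (forall m, W m -> exists N, forall v, Lam N v -> W (m + v)).

(** The action is the limit, picked by choice; the module laws follow from uniqueness of limits, and
    continuity from [g m' - f m = (g - f) m' + f (m' - m)]. *)
Lemma lt_structure_ex : exists s, lt_structure opM T s.
Proof.
have [s Hs] := choice (fun fm : lseries R * M => is_act_ex fm.2 (proj2_sig fm.1)).
exists (fun f m => s (f, m)).
have act f m : is_act (sval f) m (s (f, m)) := Hs (f, m).
split=> [f g h m hE|].
  apply: is_act_uniq (proj2_sig h) (act h m) _.
  exact: is_act_add (proj2_sig f) (proj2_sig g) hE (act f m) (act g m).
split=> [f m m'|].
  exact: is_act_uniq (proj2_sig f) (act f (m + m')) (is_actD (act f m) (act f m')).
split=> [f g h m mul|].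
  apply: is_act_uniq (proj2_sig h) (act h m) _.
  exact: is_act_mul (proj2_sig f) (proj2_sig g) mul (act g m) (act f _).
split=> [r f m fE|].
  by apply: is_act_uniq (proj2_sig f) (act f m) (is_act_mono m fE).
split=> [f m fE|].
  have := is_act_uniq (proj2_sig f) (act f m) (is_act_mono m fE).
  by rewrite scale1r.
move=> W /Ltop opW f m /= Wfm; have [N HN] := opW _ Wfm.
have [a fa] := proj2_sig f; have [c Lm] := Lam_absorb m.
(* [d >= c] keeps [m'] in [T^c L], from where a series of order at least [N - c] leads into [T^N L];
   [a + d >= N] takes care of [f (m' - m)]. *)
pose d := Order.max c (N - a).
exists (fun g => forall k, k < N - c -> sval g k = sval f k), (fun m' => Lam d (m' - m)).
have le_cd : c <= d by rewrite le_max lexx.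
have le_Nd : N <= a + d by rewrite -lerBlDl le_max lexx orbT.
split=> [g gf|].
  by exists (N - c) => g' g'g k ltk; rewrite g'g ?gf.
split.
  apply/Ltop => m1 H1; exists d => v Hv /=; rewrite addrAC.
  exact (submodD (Lam_submod d) H1 Hv).
split=> //; split; first by rewrite subrr; apply: (submod0 (Lam_submod d)).
move=> g m' gf Hm'.
have hb : lbound (fun k => sval g k - sval f k) (N - c).
  by move=> k ltk; rewrite gf ?subrr.
pose h : lseries R := mk_lseries hb.
have Lm' : Lam c m'.
  rewrite -(subrK m m'); apply: (submodD (Lam_submod c) _ Lm).
  exact: Lam_le Hm'.
have E1 : s (g, m') = s (f, m') + s (h, m').
  apply: is_act_uniq (proj2_sig g) (act g m') _.
  apply: is_act_add (proj2_sig f) (proj2_sig h) _ (act f m') (act h m').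
  by move=> n /=; rewrite addrC subrK.
have E2 : s (f, m') = s (f, m) + s (f, m' - m).
  apply: is_act_uniq (proj2_sig f) (act f m') _.
  rewrite -{1}(subrK m m') addrC; exact: is_actD.
rewrite E1 E2 -addrA; apply: HN; apply: (submodD (Lam_submod N) _ _).
  apply: Lam_le le_Nd _; exact: is_act_Lam fa (act _ _) Hm'.
have := is_act_Lam hb (act h m') Lm'.
by rewrite subrK.
Qed.

(** The axioms fix the action of monomials, hence of truncated series by additivity, and continuity
    in the series passes to the limit. *)
Lemma lt_structure_act s : lt_structure opM T s ->
  forall f m, is_act (sval f) m (s f m).
Proof.
case=> sD [sDr] [sM] [sC] [sT] sc f m.
have sNat (n : nat) x : s (lmono 1 n%:Z) x = iter n T x.
  elim: n x => [|n IHn] x; first by rewrite (sC 1) // scale1r.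
  rewrite (sM (lmono 1 1) (lmono 1 n%:Z)) ?IHn /=; first exact: sT.
  by have := @mono_mul R 1 1 1 n%:Z; rewrite mulr1 -intS.
have spw n x : s (lmono 1 n) x = pw n x.
  case: n => n; first exact: sNat.
  (* A negative power of [t] is inverse to a positive one, so it acts as the inverse of the positive
     power of [T]. *)
  rewrite -[LHS](pwK n.+1%:Z) NegzE; congr (pw _ _).
  rewrite -[pw n.+1%:Z _]/(iter n.+1 T _) -sNat -NegzE.
  rewrite -[RHS]scale1r -(sC 1 (lmono 1 0)) //; symmetry; apply: sM => /=.
  have := @mono_mul R 1 1 n.+1%:Z (Negz n).
  by rewrite mulr1; have -> : n.+1%:Z + Negz n = 0 by lia.
have smono r n x : s (lmono r n) x = r *: pw n x.
  rewrite (sM (lmono r 0) (lmono 1 n)) ?spw /=; first exact: sC.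
  by have := @mono_mul R r 1 0 n; rewrite mulr1 add0r.
have s0 z x : (forall n, sval z n = 0) -> s z x = 0.
  by move=> z0; rewrite (sC 0) ?scale0r // => n; rewrite z0 if_same.
have [a fa] := proj2_sig f; apply: (is_act_at fa) => N.
have spoly k (g : lseries R) :
    (forall n, sval g n = if n < a + k%:Z then sval f n else 0) ->
    s g m = psum (sval f) a k m.
  elim: k g => [|k IHk] g gE.
    rewrite /psum big_ord0; apply: s0 => n; rewrite gE addr0.
    by case: ifP => // ltn; apply: fa.
  have [g1 [_ [g1E _ _]]] := lseries_trunc f (a + k%:Z).
  rewrite (sD g1 (lmono (sval f (a + k%:Z)) (a + k%:Z))).
    by rewrite (IHk g1) // smono /psum big_ord_recr.
  move=> n; rewrite gE g1E /= /mono.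
  have [->|/eqP ne] := eqVneq n (a + k%:Z).
    by rewrite ltxx add0r; have -> : a + k%:Z < a + k.+1%:Z by lia.
  by rewrite addr0; congr (if _ then _ else _); lia.
have opN : opM (Lam N).
  apply/Ltop => x Hx; exists N => v Hv; exact (submodD (Lam_submod N) Hx Hv).
have z0 n : sval (lmono (0 : R) 0) n = 0 by rewrite /= /mono if_same.
(* Continuity at the pair of the zero series and [m]: a tail of [f] of high enough order sends [m]
   into [T^N L]. *)
have [|U [V [opU [_ [U0 [Vm UV]]]]]] := sc _ opN (lmono 0 0) m.
  by rewrite /= s0 //; apply: (submod0 (Lam_submod N)).
have [n Un] := opU _ U0.
exists (absz (n - a)%R) => k lek.
have [f1 [f2 [f1E f2E fE]]] := lseries_trunc f (a + k%:Z).
rewrite (sD _ _ _ _ fE) (spoly k f1) // addrC addKr.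
apply: UV Vm; apply: Un => i lti; rewrite z0 f2E.
by have -> : i < a + k%:Z by lia.
Qed.

End Powers.

Arguments pw : simpl never.

(** * Coordinates on [L] from a product [B -> R], and the finite dual basis *)

Section DualBasis.
Variables (R : comPzRingType) (M : lmodType R) (T Ti : {linear M -> M}).
Hypotheses (TK : cancel T Ti) (TiK : cancel Ti T).
Variables (L : M -> Prop).
Hypotheses (subL : submod L) (LT : forall x, L x -> L (T x)).
Hypothesis Labs : forall m, exists n : nat, L (iter n T m).

Local Notation pw := (pw T Ti).
Local Notation Lam := (Lam T Ti L).
Let subLam n : submod (Lam n) := Lam_submod T Ti subL n.
Let LamP := Lam_pw TK TiK L.
Let LamW := Lam_le TK TiK LT.

Definition indic (B : eqType) (b : B) : B -> R := fun c => (c == b)%:R.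

Variables (B : eqType) (pi : (B -> R) -> M) (j : M -> B -> R).
Hypothesis piP : forall a x y, pi (fun b => a * x b + y b) = a *: pi x + pi y.
Hypothesis jP : forall a m m' b, j (a *: m + m') b = a * j m b + j m' b.
Hypothesis pij : forall y, L y -> pi (j y) = y.
Hypothesis pic : forall n, exists S : seq B, forall x : B -> R,
  (forall b, b \in S -> x b = 0) -> Lam n (pi x).

Lemma pi0 x : (forall b, x b = 0) -> pi x = 0.
Proof.
move=> x0; have -> : x = fun b => -1 * x b + x b by apply/funext => b; rewrite x0 mulr0 addr0.
by rewrite piP scaleN1r addNr.
Qed.

Lemma piB x y : pi (fun b => x b - y b) = pi x - pi y.
Proof.
rewrite addrC -scaleN1r -piP; congr pi; apply/funext => b.
by rewrite mulN1r addrC.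
Qed.

Lemma pi_split (S : seq B) x : uniq S ->
  pi x = \sum_(b <- S) x b *: pi (indic b) + pi (fun b => if b \in S then 0 else x b).
Proof.
elim: S => [|b S IHS] /=; first by rewrite big_nil add0r.
case/andP=> bS /IHS ->; rewrite big_cons [_ *: _ + _]addrC -addrA; congr (_ + _).
rewrite -piP; congr pi; apply/funext => c; rewrite inE /indic.
by have [->|_] := eqVneq c b; rewrite ?(negPf bS) ?mulr1 ?mulr0 ?addr0 ?add0r.
Qed.

(** Away from a finite set of coordinates [pi] lands in [L]; each of the finitely many remaining
    basis vectors has its image in some [T^a L]. *)
Lemma pi_bounded : exists a, forall x, Lam a (pi x).
Proof.
have [S HS] := pic 0; pose S' := undup S.
have [|k|a Ha] := @common_lower_bound (size S')
  (fun k a => Lam a (pi (indic (tnth (in_tuple S') k)))).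
- by move=> k a a'; apply: LamW.
- exact: Lam_absorb.
exists (Order.min a 0) => x; rewrite (pi_split x (undup_uniq S)).
apply: (submodD (subLam _)).
  rewrite big_tnth; apply: (submod_sum (subLam _)) => k _.
  apply: (submodZ (subLam _)); apply: LamW (Ha k).
  by rewrite ge_min lexx.
apply: (@LamW _ 0); first by rewrite ge_min lexx orbT.
by apply: HS => b; rewrite mem_undup => ->.
Qed.

Section Complete.
Hypothesis jc : forall b, exists n : nat, forall m, Lam n%:Z m -> j m b = 0.

(** Each coordinate of [j] kills some [T^n L], so all coordinates of [m] vanish, and they determine
    [m]. *)
Lemma Lam_separated m : (forall n, Lam n m) -> m = 0.
Proof.
move=> Lm; rewrite -(pij (y := m)); last by have := Lm 0; rewrite Lam0.
by apply: pi0 => b; have [n ->] := jc b.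
Qed.

(** Each coordinate of the partial sums is eventually constant; [pi] of the eventual values is the
    limit. *)
Lemma Lam_complete (v : nat -> M) : (forall i, L (v i)) ->
  exists m, forall n : nat, Lam n%:Z (m - \sum_(i < n) pw i%:Z (v i)).
Proof.
move=> Lv; have [N HN] := choice jc.
have LT' (i k : nat) : (k <= i)%N -> Lam k%:Z (pw i%:Z (v i)).
  by move=> lei; apply: (@LamW _ (i%:Z + 0)); rewrite ?LamP ?Lam0 //; lia.
pose z n b := \sum_(i < n) j (pw i%:Z (v i)) b.
have piz n : pi (z n) = \sum_(i < n) pw i%:Z (v i).
  elim: n => [|n IHn]; first by rewrite big_ord0 pi0 // => b; rewrite /z big_ord0.
  rewrite big_ord_recr /= -IHn -[pw _ _]pij; last by rewrite -(Lam0 T Ti); apply: LT'.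
  rewrite addrC -[pi (j _)]scale1r -piP; congr pi; apply/funext => b.
  by rewrite /z big_ord_recr /= mul1r addrC.
have zE b n n' : (N b <= n)%N -> (n <= n')%N -> z n' b = z n b.
  move=> leb /subnKC<-; rewrite /z big_split_ord /= [X in _ + X]big1 ?addr0 // => i _.
  by apply: HN; apply: LT'; lia.
exists (pi (fun b => z (N b) b)) => n.
have [S HS] := pic n%:Z.
(* By index [K] all coordinates in [S] have stabilised, so the remainder vanishes on [S] and [pi]
   sends it into [T^n L]. *)
pose K := (n + \sum_(b <- S) N b)%N.
have -> : pi (fun b => z (N b) b) - \sum_(i < n) pw i%:Z (v i) =
   pi (fun b => z (N b) b - z K b) + \sum_(i < K - n) pw (n + i)%N%:Z (v (n + i)%N).
  have -> : (K - n = \sum_(b <- S) N b)%N by rewrite /K addKn.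
  by rewrite piB piz /K big_split_ord /= opprD addrA subrK.
apply: (submodD (subLam _)); last first.
  by apply: (submod_sum (subLam _)) => i _; apply: LT'; rewrite leq_addr.
apply: HS => b bS; rewrite (@zE b (N b) K) ?subrr // /K.
by rewrite (big_rem b) //=; lia.
Qed.

End Complete.

Variable us : seq M.
Hypothesis Lfg : forall m, L m -> exists c : nat -> R,
  Lam 1 (m - \sum_(k < size us) c k *: nth 0 us k).

(** Successive approximation: reduce modulo [T^(a+1) L], divide the rest by [T], repeat. The choices
    of coefficients are not linear, so they are used only on the vectors [indic b] and extended
    linearly. *)
Lemma pi_expansion : exists (a : int) (u : 'I_(size us) -> M)
    (sig : nat -> (B -> R) -> 'I_(size us) -> R),
  (forall i t x y k, sig i (fun b => t * x b + y b) k = t * sig i x k + sig i y k) /\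
  (forall x (n : nat),
    Lam (a + n%:Z) (pi x - \sum_(i < n) pw i%:Z (\sum_k sig i x k *: u k))).
Proof.
have [a Ha] := pi_bounded; pose u (k : 'I_(size us)) := pw a (nth 0 us k).
exists a, u.
(* Taking zero coefficients on all of [T^(a+1) L] makes the expansion of a deep element start late;
   the finite supports [Sf i] rest on this. *)
have /choice[C HC] : forall m, exists c : 'I_(size us) -> R,
    (Lam a m -> Lam (a + 1) (m - \sum_k c k *: u k)) /\
    (Lam (a + 1) m -> forall k, c k = 0).
  move=> m.
  have [L1|nL1] := pselect (Lam (a + 1) m).
    exists (fun _ => 0); split=> // _.
    by rewrite big1 ?subr0 // => k _; rewrite scale0r.
  have [L0|nL0] := pselect (Lam a m); last by exists (fun _ => 0).
  have [c Hc] := Lfg L0; exists c; split=> // _.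
  have := Hc; rewrite -(LamP 1 a) linearB /= (pwNK TK TiK) linear_sum /=.
  congr (Lam _ (_ - _)); apply: eq_bigr => k _; exact: linearZ.
pose D m := pw (-1) (m - \sum_k C m k *: u k).
have LD m : Lam a m -> Lam a (D m).
  move=> /(proj1 (HC m)) H; have -> : a = -1 + (a + 1) by lia.
  by rewrite LamP.
have Dn i m : Lam a m -> Lam a (iter i D m) by move=> Lm; elim: i => //= i /LD.
have Dvan n m i : Lam (a + n%:Z) m -> (i < n)%N -> forall k, C (iter i D m) k = 0.
  move=> Lm lti; apply: (proj2 (HC _)).
  suff /(_ i (ltnW lti)) : forall i, (i <= n)%N -> Lam (a + n%:Z - i%:Z) (iter i D m).
    by apply: LamW; lia.
  elim=> [|{lti}i IHi] lei; first by rewrite subr0.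
  have Li := IHi (ltnW lei); have L1 : Lam (a + 1) (iter i D m) by apply: LamW Li; lia.
  rewrite iterS /D big1 ?subr0 => [|k _]; last by rewrite (proj2 (HC _)) ?scale0r.
  have -> : a + n%:Z - i.+1%:Z = -1 + (a + n%:Z - i%:Z) by lia.
  by rewrite LamP.
have Dexp m n : m - \sum_(i < n) pw i%:Z (\sum_k C (iter i D m) k *: u k) =
    pw n%:Z (iter n D m).
  elim: n => [|n IHn]; first by rewrite big_ord0 subr0.
  rewrite big_ord_recr /= opprD addrA IHn -linearB.
  have -> : n.+1%:Z = n%:Z + 1 by lia.
  by rewrite (pwD TK TiK) /D (pwNK TK TiK 1).
have [Sf HSf] := choice (fun i : nat => pic (a + i.+1%:Z)).
pose cf b i := C (iter i D (pi (indic b))).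
have cf0 b i : b \notin Sf i -> forall k, cf b i k = 0.
  move=> bS; apply: (@Dvan i.+1) => //; apply: HSf => c cS.
  by rewrite /indic; case: eqP cS bS => // -> ->.
(* For fixed [i] only the [b] in [Sf i] contribute, so the linear extension is a finite sum. *)
exists (fun i x k => \sum_(b <- undup (Sf i)) x b * cf b i k); split.
  move=> i t x y k; rewrite mulr_sumr -big_split; apply: eq_bigr => b _ /=.
  by rewrite mulrDl mulrA.
(* One finite set covers the supports for all [i < n]; including [Sf n] also puts [pi] of the
   remaining coordinates into [T^(a+n+1) L]. *)
move=> x n; pose S' := undup (flatten (map Sf (iota 0 n.+1))).
have sigE i k : (i < n)%N -> \sum_(b <- undup (Sf i)) x b * cf b i k =
    \sum_(b <- S') x b * cf b i k.
  move=> lti; apply: big_uniq_supp; rewrite ?undup_uniq // => b; rewrite mem_undup => bS.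
    by rewrite cf0 ?mulr0.
  rewrite cf0 ?mulr0 //; apply: contra bS => bS; apply/flattenP.
  by exists (Sf i) => //; apply: map_f; rewrite mem_iota; lia.
have sub := subLam (a + n%:Z).
rewrite (pi_split x (undup_uniq _ : uniq S')).
have -> : \sum_(i < n) pw i%:Z
      (\sum_k (\sum_(b <- undup (Sf i)) x b * cf b i k) *: u k) =
    \sum_(b <- S') x b *: (\sum_(i < n) pw i%:Z (\sum_k cf b i k *: u k)).
  under [RHS]eq_bigr do rewrite scaler_sumr.
  rewrite exchange_big /=; apply: eq_bigr => i _.
  under [RHS]eq_bigr do rewrite -linearZ /= scaler_sumr.
  rewrite -linear_sum exchange_big /=; congr (pw _ _); apply: eq_bigr => k _.
  by rewrite sigE // scaler_suml; apply: eq_bigr => b _; rewrite scalerA.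
rewrite addrAC -sumrB; apply: (submodD sub).
  apply: (submod_sum sub) => b _; rewrite -scalerBr Dexp.
  by apply: (submodZ sub); rewrite addrC LamP; apply: Dn.
apply: (@LamW _ (a + n.+1%:Z)); first by lia.
apply: HSf => b bS; have -> // : b \in S'.
by rewrite mem_undup; apply/flattenP; exists (Sf n) => //; apply: map_f; rewrite mem_iota; lia.
Qed.

Variables (th : {linear M -> M}) (n0 : int).
Hypotheses (thL : forall m, L (th m)) (thid : forall m, Lam n0 m -> th m = m).

(** With [tau i] the [i]-th expansion coefficients of [beta], the terms [T^(l+i)] with coefficients
    [tau i (T^-l m)] are grouped by [n = l + i]. Since [T^-l = T^i T^-n], the coefficient of [T^n]
    is one and the same form [lam k] evaluated at [T^-n m]. *)
Lemma dual_basis_ex : exists (lam : 'I_(size us) -> M -> R) (u : 'I_(size us) -> M) (n1 e : int),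
  [/\ forall k t x y, lam k (t *: x + y) = t * lam k x + lam k y,
      forall k m, Lam n1 m -> lam k m = 0
    & forall m, Lam n1 m -> forall K : nat,
        Lam (e + K%:Z) (m - \sum_(n < K) \sum_k lam k (pw (- n%:Z) m) *: pw n%:Z (u k))].
Proof.
have [a [u [sig [sigP sigE]]]] := pi_expansion.
(* For [beta m] to vanish, both [m] and [T^-1 m] have to lie where [th] is the identity. *)
pose n1 := n0 + 1.
pose beta m := th m - pw 1 (th (pw (-1) m)).
have betaP t x y : beta (t *: x + y) = t *: beta x + beta y.
  by rewrite /beta !linearP scalerDr addrACA.
have betaL m : L (beta m).
  rewrite /beta; apply: (submodB subL) => //; exact: LT.
have beta0 m : Lam n1 m -> beta m = 0.
  move=> Lm; have L0 : Lam n0 m by apply: LamW Lm; rewrite /n1; lia.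
  have L1 : Lam n0 (pw (-1) m).
    by have -> : n0 = -1 + n1 by [rewrite /n1; lia]; rewrite LamP.
  by rewrite /beta !thid // (pwNK TK TiK 1) subrr.
pose tau i m k := sig i (j (beta m)) k.
have tauP i t x y k : tau i (t *: x + y) k = t * tau i x k + tau i y k.
  rewrite /tau -sigP betaP; congr (sig _ _ _); apply/funext => b; exact: jP.
have tau0 i m k : Lam n1 m -> tau i m k = 0.
  move=> /beta0 b0; have b00 : beta 0 = 0 by apply: beta0; apply: submod0.
  by have := tauP i (-1) m m k; rewrite scaleN1r addNr mulN1r addNr /tau b00 b0.
have /choice[Nm HNm] : forall m, exists N : nat, forall i, (N <= i)%N -> Lam n1 (pw i%:Z m).
  move=> m; have [c Lc] := Lam_absorb Ti Labs m.
  exists (absz (n1 - c)%R) => i lei; apply: (@LamW _ (i%:Z + c)); first by lia.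
  by rewrite LamP.
(* [T^i m] eventually lies where [tau] vanishes, so the sum over all [i >= 0] is cut at [Nm m];
   [lamE] permits any other valid cut. *)
pose lam k m := \sum_(i < Nm m) tau i (pw i%:Z m) k.
have lamE k m K : (forall i, (K <= i)%N -> Lam n1 (pw i%:Z m)) ->
    lam k m = \sum_(i < K) tau i (pw i%:Z m) k.
  have ext N N' : (forall i, (N <= i)%N -> Lam n1 (pw i%:Z m)) -> (N <= N')%N ->
      \sum_(i < N) tau i (pw i%:Z m) k = \sum_(i < N') tau i (pw i%:Z m) k.
    move=> HN /subnKC<-; rewrite [RHS]big_split_ord /= [X in _ = _ + X]big1 ?addr0 // => i _.
    by apply: tau0; apply: HN; rewrite leq_addr.
  move=> HK; rewrite /lam (ext _ (maxn (Nm m) K)) ?leq_maxl //; last exact: HNm.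
  by rewrite -(ext K) ?leq_maxr.
(* [a] bounds the error of the expansion along [u], and [0] that of the remainder [T^K th T^-K m],
   which lies in [T^K L]. *)
exists lam, u, n1, (Order.min a 0); split.
- move=> k t x y; pose K := maxn (Nm x) (Nm y).
  have Kx i : (K <= i)%N -> Lam n1 (pw i%:Z x) by rewrite geq_max => /andP[/HNm].
  have Ky i : (K <= i)%N -> Lam n1 (pw i%:Z y) by rewrite geq_max => /andP[_ /HNm].
  rewrite (@lamE k x K) // (@lamE k y K) // (@lamE k _ K) => [|i lei].
    by rewrite mulr_sumr -big_split; apply: eq_bigr => i _; rewrite linearP tauP.
  rewrite linearP; apply: (submodD (subLam _)); last exact: Ky.
  by apply: (submodZ (subLam _)); apply: Kx.
- move=> k m Lm; rewrite (@lamE k m 0) ?big_ord0 // => i _.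
  by apply: (@LamW _ (i%:Z + n1)); [lia | rewrite LamP].
move=> m Lm K.
pose F l i := \sum_k tau i (pw (- l%:Z) m) k *: pw (l + i)%N%:Z (u k).
have -> : \sum_(n < K) \sum_k lam k (pw (- n%:Z) m) *: pw n%:Z (u k) =
    \sum_(l < K) \sum_(i < K - l) F l i.
  rewrite -sum_triangle; apply: eq_bigr => n _.
  under eq_bigr => k _.
    rewrite (@lamE k _ n.+1) => [|i lei]; first rewrite scaler_suml; first over.
    rewrite -(pwD TK TiK); apply: (@LamW _ (i%:Z - n%:Z + n1)); first by lia.
    by rewrite LamP.
  (* Reversal turns the expansion index [i] into the telescoping index [l = n - i]. *)
  rewrite exchange_big (reindex_inj rev_ord_inj) /=; apply: eq_bigr => i _.
  have lei : (i <= n)%N by rewrite -ltnS.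
  rewrite subSS /F; apply: eq_bigr => k _.
  rewrite -(pwD TK TiK); congr (tau _ (pw _ _) _ *: pw _ _); lia.
(* The sum can start at [l = 0] because [th m = m] for [m] in [T^n1 L]. *)
have tele : \sum_(l < K) pw l%:Z (beta (pw (- l%:Z) m)) = m - pw K%:Z (th (pw (- K%:Z) m)).
  elim: K => [|K IHK].
    rewrite big_ord0 /= [th _]thid; last by apply: LamW Lm; rewrite /n1; lia.
    by rewrite [pw 0 _]/= subrr.
  rewrite big_ord_recr /= IHK /beta linearB /= addrA subrK; congr (_ - _).
  by rewrite -!(pwD TK TiK); congr (pw _ (th (pw _ m))); lia.
have -> : m = pw K%:Z (th (pw (- K%:Z) m)) + \sum_(l < K) pw l%:Z (beta (pw (- l%:Z) m)).
  by rewrite tele addrC subrK.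
rewrite -addrA -sumrB; apply: (submodD (subLam _)).
  apply: (@LamW _ (K%:Z + 0)); first by lia.
  by rewrite LamP Lam0.
apply: (submod_sum (subLam _)) => l _.
apply: (@LamW _ (a + K%:Z)); first by lia.
have := sigE (j (beta (pw (- l%:Z) m))) (K - l)%N.
rewrite pij // -(LamP _ l%:Z) linearB linear_sum /=.
congr (Lam _ (_ - _)); first by have := ltn_ord l; lia.
apply: eq_bigr => i _; rewrite -(pwD TK TiK) linear_sum; apply: eq_bigr => k _.
by rewrite linearZ.
Qed.

End DualBasis.

(** * The dual basis over [R((t))]: projectivity and the standard topology *)

Section Standard.
Variables (R : comPzRingType) (M : lmodType R) (T Ti : {linear M -> M}).
Hypotheses (TK : cancel T Ti) (TiK : cancel Ti T).
Variables (L : M -> Prop).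
Hypotheses (subL : submod L) (LT : forall x, L x -> L (T x)).
Hypothesis Labs : forall m, exists n : nat, L (iter n T m).

Local Notation pw := (pw T Ti).
Local Notation Lam := (Lam T Ti L).
Let subLam n : submod (Lam n) := Lam_submod T Ti subL n.
Let LamP := Lam_pw TK TiK L.
Let LamW := Lam_le TK TiK LT.

Hypothesis Lsep : forall m, (forall n, Lam n m) -> m = 0.
Variable opM : (M -> Prop) -> Prop.
Hypothesis Ltop : forall W, opM W <->
  (forall m, W m -> exists N, forall v, Lam N v -> W (m + v)).

Variables (r : nat) (lam : 'I_r -> M -> R) (u : 'I_r -> M) (n1 e : int).
Hypothesis lamP : forall k t x y, lam k (t *: x + y) = t * lam k x + lam k y.
Hypothesis lam0 : forall k m, Lam n1 m -> lam k m = 0.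
Hypothesis lamE : forall m, Lam n1 m -> forall K : nat,
  Lam (e + K%:Z) (m - \sum_(n < K) \sum_k lam k (pw (- n%:Z) m) *: pw n%:Z (u k)).

(** The [R((t))]-linear map to [R((t))] whose constant coefficient is the [R]-linear form
    [lam k]. *)
Definition coord_fun (m : M) (k : 'I_r) : int -> R := fun n => lam k (pw (- n) m).

Lemma coord_lbound c m k : Lam c m -> lbound (coord_fun m k) (c - n1).
Proof.
move=> Lm n ltn; apply: lam0; apply: (@LamW _ (- n + c)); first by lia.
by rewrite LamP.
Qed.

Lemma coord_ex m k : exists a, lbound (coord_fun m k) a.
Proof.
by have [c /coord_lbound H] := Lam_absorb Ti Labs m; exists (c - n1).
Qed.

Definition coord m k : lseries R := exist _ (coord_fun m k) (coord_ex m k).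

Variable s : lseries R -> M -> M.
Hypothesis lts : lt_structure opM T s.

Let act := lt_structure_act TK TiK subL Ltop lts.

Lemma lamD k x y : lam k (x + y) = lam k x + lam k y.
Proof. by have := lamP k 1 x y; rewrite scale1r mul1r. Qed.

Lemma coordD m m' k n :
  sval (coord (m + m') k) n = sval (coord m k) n + sval (coord m' k) n.
Proof. by rewrite /= /coord_fun linearD lamD. Qed.

Lemma lam_lin0 k : lam k 0 = 0.
Proof. by apply: lam0; apply: submod0. Qed.

Lemma lamZ k t x : lam k (t *: x) = t * lam k x.
Proof. by rewrite -[t *: x]addr0 lamP lam_lin0 addr0. Qed.

Lemma lam_sum k I (q : seq I) (F : I -> M) :
  lam k (\sum_(i <- q) F i) = \sum_(i <- q) lam k (F i).
Proof.
by apply: (big_morph (lam k)); [apply: lamD | apply: lam_lin0].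
Qed.

(** [lam k] after [T^-n] kills [T^(n+n1) L], so the [n]-th coefficient at [s f m] can be read off a
    finite partial sum, where linearity gives the convolution. *)
Lemma coordM f m k :
  is_lmul (sval f) (sval (coord m k)) (sval (coord (s f m) k)).
Proof.
move=> a b fa gb n /=.
have [K HK] := @act f m a fa (n + n1).
pose K' := (K + (absz (n - a - b)%R).+1)%N.
rewrite (@conv_winE _ _ _ a b n K' gb); last by rewrite /K'; lia.
have HK' : Lam (n + n1) (s f m - psum T Ti (sval f) a K' m).
  by apply: HK; rewrite leq_addr.
rewrite /coord_fun -[s f m](subrK (psum T Ti (sval f) a K' m)) addrC.
rewrite linearD lamD.
rewrite [X in _ + X]lam0 ?addr0; last first.
  by have -> : n1 = - n + (n + n1) by [lia]; rewrite LamP.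
rewrite linear_sum lam_sum; apply: eq_bigr => i _.
rewrite linearZ /= lamZ /coord_fun -(pwD TK TiK); congr (_ * lam k (pw _ _)); lia.
Qed.

(** For every [N] both sides agree modulo [T^N L] with the same finite double sum; separation
    concludes. *)
Lemma coord_expansion m : \sum_k s (coord m k) (u k) = m.
Proof.
have [c Lm] := Lam_absorb Ti Labs m; pose a := c - n1.
have [|k|d Hd] := @common_lower_bound r (fun k d => Lam d (u k)).
- by move=> k x y; apply: LamW.
- exact: Lam_absorb.
apply/subr0_eq/Lsep => N.
pose K := (absz (N - a - d)%R + absz (N - a - e)%R)%N.
(* The approximation [lamE] holds on [T^n1 L], so [m] is first moved there. *)
pose m0 := pw (- a) m.
have Lm0 : Lam n1 m0 by have -> : n1 = - a + c by [rewrite /a; lia]; rewrite LamP.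
have H1 : Lam N (\sum_k s (coord m k) (u k) -
                 \sum_k psum T Ti (coord_fun m k) a K (u k)).
  rewrite -sumrB; apply: (submod_sum (subLam N)) => k _.
  apply: (@LamW _ (a + d + K%:Z)); first by rewrite /K; lia.
  apply: (is_act_exact TK TiK subL LT K (coord_lbound k Lm)) (Hd k).
  exact: (@act (coord m k)).
have H2 : Lam N (m - \sum_k psum T Ti (coord_fun m k) a K (u k)).
  apply: (@LamW _ (a + (e + K%:Z))); first by rewrite /K; lia.
  have := lamE Lm0 K; rewrite -(LamP _ a) linearB /= /m0 (pwNK TK TiK).
  congr (Lam _ (_ - _)); rewrite exchange_big linear_sum; apply: eq_bigr => k _.
  rewrite linear_sum; apply: eq_bigr => i _.
  rewrite linearZ /= -!(pwD TK TiK); congr (lam k (pw _ _) *: _); lia.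
have := submodB (subLam N) H1 H2.
by rewrite opprB addrA subrK.
Qed.

Lemma lt_structure_fg_projective : fg_projective s.
Proof.
have [sD [sDr [sM _]]] := lts.
exists r, coord, (fun w => \sum_k s (w k) (u k)); split; first exact: coordD.
split; first exact: coordM.
split=> [w v v' wE|]; first by rewrite -big_split; apply: eq_bigr => k _; apply: sD.
split=> [f v w wE|]; last exact: coord_expansion.
rewrite (big_morph (s f) (sDr f) (id1 := 0)); first by apply: eq_bigr => k _; apply: sM.
by apply: (addrI (s f 0)); rewrite -sDr !addr0.
Qed.

(** [phi v] is the combination of the series [phi (u k)] with the coordinates of [v], and the orders
    of these coordinates grow with the depth of [v] in the filtration. *)
Lemma lt_structure_standard_topology : standard_topology opM s.
Proof.
move=> phi phiD phiM V opV; apply/Ltop => m Vm.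
have [n Vn] := opV _ Vm.
have [|k|d Hd] := @common_lower_bound r (fun k d => lbound (sval (phi (u k))) d).
- by move=> k x y; apply: lbound_le.
- exact: proj2_sig (phi (u k)).
exists (n - d + n1) => v Lv; apply: Vn => i lti; rewrite phiD.
rewrite -[X in _ + X]/((fun x => sval (phi x) i) v) -(coord_expansion v).
rewrite (big_morph (fun x => sval (phi x) i) (id1 := 0) (op1 := +%R)) => [|x y|]; last 2 first.
- exact: phiD.
- by apply: (addrI (sval (phi 0) i)); rewrite -phiD !addr0.
rewrite big1 ?addr0 // => k _.
apply: (lbound_mul (coord_lbound k Lv) (Hd k) (phiM (coord v k) (u k))); lia.
Qed.

End Standard.

(** * Free modules as finitely supported functions *)

Section FreeModule.
Variables (R : comPzRingType) (X : eqType).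

Definition finite_support (f : X -> R) : Prop :=
  exists s : seq X, forall x, x \notin s -> f x = 0.

Definition free_mod := {f : X -> R | finite_support f}.

HB.instance Definition _ := gen_eqMixin free_mod.
HB.instance Definition _ := gen_choiceMixin free_mod.

Lemma free_mod_ext (f g : free_mod) : sval f =1 sval g -> f = g.
Proof.
case: f g => [f pf] [g pg] /= /funext fg; rewrite -{}fg in pg *.
by congr exist; apply: Prop_irrelevance.
Qed.

Lemma finite_supportP (a : R) (f g : free_mod) :
  finite_support (fun x => a * sval f x + sval g x).
Proof.
case: f g => [f [s fs]] [g [s' gs]] /=; exists (s ++ s') => x.
by rewrite mem_cat negb_or => /andP[/fs-> /gs->]; rewrite mulr0 addr0.
Qed.

Definition free_comb a f g : free_mod := exist _ _ (finite_supportP a f g).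

Lemma finite_support0 : finite_support (fun=> 0).
Proof. by exists [::]. Qed.

Definition free_zero : free_mod := exist _ _ finite_support0.
Definition free_add f g := free_comb 1 f g.
Definition free_opp f := free_comb (-1) f free_zero.
Definition free_scale a f := free_comb a f free_zero.

Lemma free_addA : associative free_add.
Proof. by move=> f g h; apply: free_mod_ext => x /=; rewrite !mul1r addrA. Qed.
Lemma free_addC : commutative free_add.
Proof. by move=> f g; apply: free_mod_ext => x /=; rewrite !mul1r addrC. Qed.
Lemma free_add0 : left_id free_zero free_add.
Proof. by move=> f; apply: free_mod_ext => x /=; rewrite mulr0 add0r. Qed.
Lemma free_addN : left_inverse free_zero free_opp free_add.
Proof.
by move=> f; apply: free_mod_ext => x /=; rewrite mul1r addr0 mulN1r addNr.
Qed.

HB.instance Definition _ :=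
  GRing.isZmodule.Build free_mod free_addA free_addC free_add0 free_addN.

Lemma free_scaleA a b f : free_scale a (free_scale b f) = free_scale (a * b) f.
Proof. by apply: free_mod_ext => x /=; rewrite !addr0 mulrA. Qed.
Lemma free_scale1 : left_id 1 free_scale.
Proof. by move=> f; apply: free_mod_ext => x /=; rewrite addr0 mul1r. Qed.
Lemma free_scaleDr : right_distributive free_scale +%R.
Proof.
by move=> a f g; apply: free_mod_ext => x /=; rewrite !mul1r !addr0 mulrDr.
Qed.
Lemma free_scaleDl f : {morph free_scale^~ f : a b / a + b}.
Proof. by move=> a b; apply: free_mod_ext => x /=; rewrite mul1r !addr0 mulrDl. Qed.

HB.instance Definition _ := GRing.Zmodule_isLmodule.Build R free_mod
  free_scaleA free_scale1 free_scaleDr free_scaleDl.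

Lemma free_linE a (f g : free_mod) x :
  sval (a *: f + g) x = a * sval f x + sval g x.
Proof. by rewrite /= mul1r addr0. Qed.

(** A chosen support without repetitions; it may contain points where [f] vanishes. *)
Definition free_supp (f : free_mod) : seq X := undup (projT1 (cid (proj2_sig f))).

Lemma free_suppP f x : x \notin free_supp f -> sval f x = 0.
Proof. by rewrite mem_undup; case: cid => s /= fs; apply: fs. Qed.

End FreeModule.

(** * Dual bases of projective modules *)

Section ProjectiveDualBasis.
Variables (R : comPzRingType) (P : lmodType R).

Definition free_eval (f : free_mod R P) : P := \sum_(b <- free_supp f) sval f b *: b.

Lemma free_evalE (f : free_mod R P) s : uniq s ->
  (forall x, x \notin s -> sval f x = 0) -> free_eval f = \sum_(b <- s) sval f b *: b.
Proof.
move=> us fs; apply: big_uniq_supp => //; first exact: undup_uniq.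
- by move=> x /free_suppP ->; rewrite scale0r.
- by move=> x /fs ->; rewrite scale0r.
Qed.

Lemma free_eval_linear : linear free_eval.
Proof.
move=> a f g; pose s := undup (free_supp f ++ free_supp g).
have fs x : x \notin s -> sval f x = 0.
  by rewrite mem_undup mem_cat negb_or => /andP[/free_suppP].
have gs x : x \notin s -> sval g x = 0.
  by rewrite mem_undup mem_cat negb_or => /andP[_ /free_suppP].
have us : uniq s by apply: undup_uniq.
rewrite (free_evalE us fs) (free_evalE us gs) (free_evalE (s := s)) //; last first.
  by move=> x xs; rewrite free_linE fs // gs // mulr0 addr0.
rewrite scaler_sumr -big_split; apply: eq_bigr => x _ /=.
by rewrite mul1r addr0 scalerDl scalerA.
Qed.

HB.instance Definition _ := GRing.isLinear.Build R (free_mod R P) P _ free_eval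
  free_eval_linear.

(** The identity of [P] lifts through the free module on the underlying set of [P]; the coordinates
    of this section form the dual basis. *)
Lemma projective_dual_basis : projective_mod P ->
  exists (c : P -> P -> R) (supp : P -> seq P),
  [/\ forall a x y b, c (a *: x + y) b = a * c x b + c y b,
      forall x b, b \notin supp x -> c x b = 0,
      forall x, uniq (supp x)
    & forall x, x = \sum_(b <- supp x) c x b *: b].
Proof.
move=> projP.
have [|h hP] := projP (free_mod R P) P free_eval idfun.
  move=> b; have bs : finite_support (indic R b).
    by exists [:: b] => x; rewrite inE /indic => /negPf->.
  pose f : free_mod R P := exist _ _ bs.
  exists f; rewrite -[LHS]/(free_eval f) (@free_evalE _ [:: b]) //=.
    by rewrite big_seq1 /indic eqxx scale1r.
  by move=> x; rewrite inE /indic => /negPf->.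
exists (fun x => sval (h x)), (fun x => free_supp (h x)); split=> [a x y b|x b|x|x].
- by rewrite linearP free_linE.
- exact: free_suppP.
- exact: undup_uniq.
- by rewrite -[LHS](hP x).
Qed.

End ProjectiveDualBasis.

(** * Coordinates on a Tate module *)

Section TateData.
Variables (R : comPzRingType) (M : lmodType R) (opM : (M -> Prop) -> Prop).

Definition vanish (B : eqType) (S : seq B) (x : B -> R) : Prop :=
  forall b, b \in S -> x b = 0.

(* [m = \sum_b nu m b *: g b + pi (j m)] presents [M] as a retract of the sum of a
   free module and of the product [B -> R]. *)
Lemma tate_coordinates : tate_module opM ->
  exists (B B' : eqType) (pi : (B -> R) -> M) (j : M -> B -> R)
    (nu : M -> B' -> R) (supp : M -> seq B') (g : B' -> M),
  ((forall a x y, pi (fun b => a * x b + y b) = a *: pi x + pi y) /\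
   (forall a m m' b, j (a *: m + m') b = a * j m b + j m' b) /\
   (forall a m m' b, nu (a *: m + m') b = a * nu m b + nu m' b)) /\
  ((forall m b, b \notin supp m -> nu m b = 0) /\ (forall m, uniq (supp m)) /\
   (forall m, m = \sum_(b <- supp m) nu m b *: g b + pi (j m))) /\
  (forall W, opM W <-> (forall m, W m ->
     exists S, forall x, vanish S x -> W (m + pi x))) /\
  (exists S, forall x, vanish S x -> forall b, nu (pi x) b = 0) /\
  (forall b, exists S, forall x, vanish S x -> j (pi x) b = 0).
Proof.
case=> _ [P] [Q] [projP] [projQ] [i1] [i2] [p] [i1P] [i2P] [pP] [ic] [pc] pK.
have [cP [sP [cPP cPs uP cPE]]] := projective_dual_basis projP.
have [cQ [sQ [cQP cQs uQ cQE]]] := projective_dual_basis projQ.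
(* Arbitrary values [x] on the elements of [Q] give a linear form through the dual basis; by
   [lin_sum] a linear [x] is returned unchanged, so the dual of [Q] is a retract of [Q -> R]. *)
have phi_lin (x : Q -> R) : lin_form (fun q => \sum_(b <- sQ q) cQ q b * x b).
  move=> a q q'; pose s := undup (sQ (a *: q + q') ++ sQ q ++ sQ q').
  have E y : {subset sQ y <= s} ->
      \sum_(b <- sQ y) cQ y b * x b = \sum_(b <- s) cQ y b * x b.
    move=> sub; apply: big_uniq_supp; rewrite ?undup_uniq //= => b bs.
      by rewrite cQs ?mul0r.
    by rewrite cQs ?mul0r //; apply: contra bs; apply: sub.
  rewrite !E; try by move=> b bs; rewrite mem_undup !mem_cat bs ?orbT.
  rewrite mulr_sumr -big_split; apply: eq_bigr => b _ /=.
  by rewrite cQP mulrDl mulrA.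
pose phi (x : Q -> R) : dual Q := exist _ _ (phi_lin x).
have lin_sum (f : Q -> R) : lin_form f -> forall q, f q = \sum_(b <- sQ q) cQ q b * f b.
  move=> fP q; have f0 : f 0 = 0.
    by have := fP (-1) 0 0; rewrite scaler0 addr0 mulN1r addNr.
  rewrite {1}(cQE q); elim: (sQ q) => [|b t IHt]; first by rewrite !big_nil.
  by rewrite !big_cons fP IHt.
pose pi x := p (0, phi x).
have pi_p y psi chi : (forall q, sval chi q = sval psi q + sval (phi y) q) ->
    forall x, p (x, chi) = p (x, psi) + pi y.
  move=> chiE x; have := pP 1 0 x (phi y) psi chi.
  rewrite scale1r add0r scale1r addrC => -> // q.
  by rewrite chiE mul1r addrC.
have piP a x y : pi (fun b => a * x b + y b) = a *: pi x + pi y.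
  rewrite /pi; have := pP a 0 0 (phi x) (phi y) (phi (fun b => a * x b + y b)).
  rewrite scaler0 addr0; apply=> q /=; rewrite mulr_sumr -big_split.
  by apply: eq_bigr => b _ /=; rewrite mulrDr mulrCA.
pose g (b : P) := p (b, phi (fun=> 0)).
have phi00 q : sval (phi (fun=> 0)) q = 0.
  by rewrite /= big1 // => b _; rewrite mulr0.
have gP a x y : g (a *: x + y) = a *: g x + g y.
  by apply: pP => q; rewrite !phi00 mulr0 addr0.
have g0 : g 0 = 0 by have := gP (-1) 0 0; rewrite scaleN1r oppr0 addr0 scaleN1r addNr.
have gsum (t : seq P) (c : P -> R) : g (\sum_(b <- t) c b *: b) = \sum_(b <- t) c b *: g b.
  by elim: t => [|b t IHt]; rewrite ?big_nil // !big_cons gP IHt.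
pose j m (q : Q) := sval (i2 m) q.
have decomp m : m = g (i1 m) + pi (j m).
  rewrite -{1}(pK m); apply: pi_p => q.
  by rewrite phi00 add0r; apply: lin_sum; apply: (proj2_sig (i2 m)).
have top1 W : opM W -> forall m, W m -> exists S, forall x, vanish S x -> W (m + pi x).
  move=> opW m Wm.
  have [|qs Hqs] := pc W opW (i1 m) (i2 m); first by rewrite pK.
  exists (flatten (map sQ qs)) => x x0.
  have chiP : lin_form (fun q => sval (i2 m) q + sval (phi x) q).
    move=> a q q'; rewrite (proj2_sig (i2 m)) (proj2_sig (phi x)).
    by rewrite mulrDr addrACA.
  have := Hqs (exist _ _ chiP); rewrite (@pi_p x (i2 m)) // pK; apply=> q qqs /=.
  rewrite big_seq big1 ?addr0 // => b bs; rewrite x0 ?mulr0 //.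
  by apply/flattenP; exists (sQ q) => //; apply: map_f.
have opi (V : P * dual Q -> Prop) : PQ_open V -> opM (fun m => V (i1 m, i2 m)) by apply: ic.
(* The dual bases are indexed by all elements of [Q] and [P], which serve as [B] and [B']. *)
exists Q, P, pi, j, (fun m => cP (i1 m)), (fun m => sP (i1 m)), g.
split; first split=> //.
  split=> [a m m' b|a m m' b]; first exact: i2P.
  by rewrite i1P cPP.
split; first split; first by move=> m b; apply: cPs.
  split=> [m|m]; first exact: uP.
  by rewrite -gsum -cPE.
split.
  move=> W; split; first exact: top1.
  (* As [p] retracts the embedding of [M], [W] is the preimage under the embedding of its own
     preimage under [p], and openness can be checked on the sum of [P] and the dual of [Q]. *)
  move=> HW; have -> : W = fun m => W (p (i1 m, i2 m)).
    by apply/funext => m; rewrite pK.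
  apply: (opi (fun z => W (p z))) => x psi Wx.
  have [S HS] := HW _ Wx; exists S => chi chiS.
  have dP : lin_form (fun q => sval chi q - sval psi q).
    move=> a q q'; rewrite (proj2_sig chi) (proj2_sig psi).
    by rewrite mulrBr opprD addrACA.
  rewrite (@pi_p (fun q => sval chi q - sval psi q) psi).
    by apply: HS => q /chiS ->; rewrite subrr.
  by move=> q /=; rewrite -(lin_sum _ dP) addrC subrK.
have i10 : i1 0 = 0 by have := i1P (-1) 0 0; rewrite scaleN1r oppr0 addr0 scaleN1r addNr.
split.
  (* The kernel of [i1] is open because [P] is discrete. *)
  have [||S HS] := top1 (fun m => i1 m = 0) _ 0 => //.
    apply: (opi (fun z => z.1 = 0)) => x psi /= ->; by exists [::].
  exists S => x /HS; rewrite add0r => -> b.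
  have := cPP (-1) 0 0 b; by rewrite scaleN1r oppr0 addr0 mulN1r addNr.
move=> b.
have [||S HS] := top1 (fun m => sval (i2 m) b = 0) _ 0.
- apply: (opi (fun z => sval z.2 b = 0)) => x psi /= psib; exists [:: b] => chi.
  by move=> ->; rewrite ?inE.
- by have := i2P (-1) 0 0 b; rewrite scaleN1r oppr0 addr0 mulN1r addNr.
by exists S => x /HS; rewrite add0r.
Qed.

End TateData.

(** * Spans of finite sequences *)

Section Span.
Variables (R : comPzRingType) (M : lmodType R).

Definition span (us : seq M) (v : M) : Prop :=
  exists c : nat -> R, v = \sum_(k < size us) c k *: nth 0 us k.

Lemma span_submod us : submod (span us).
Proof.
split=> [|a x y [c ->] [d ->]].
  by exists (fun=> 0); rewrite big1 // => k _; rewrite scale0r.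
exists (fun k => a * c k + d k); rewrite scaler_sumr -big_split.
by apply: eq_bigr => k _ /=; rewrite scalerDl scalerA.
Qed.

Lemma span_mem us v : v \in us -> span us v.
Proof.
move=> vus; have lt_i : (index v us < size us)%N by rewrite index_mem.
exists (fun k => (k == index v us)%:R).
rewrite (bigD1 (Ordinal lt_i)) //= eqxx scale1r nth_index // big1 ?addr0 // => k.
by rewrite -val_eqE /= => /negPf->; rewrite scale0r.
Qed.

End Span.

(** * A [T]-stable lattice and its translates *)

Section LatticeConstruction.
Variables (R : comPzRingType) (M : lmodType R) (opM : (M -> Prop) -> Prop).
Variables (T Ti : {linear M -> M}).
Hypotheses (TK : cancel T Ti) (TiK : cancel Ti T).
Hypotheses (Tc : continuous_for opM opM T) (Tic : continuous_for opM opM Ti).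
Hypothesis Tnil : top_nilpotent opM T.

Variables (B B' : eqType) (pi : (B -> R) -> M) (j : M -> B -> R).
Variables (nu : M -> B' -> R) (supp : M -> seq B') (g : B' -> M).
Hypothesis piP : forall a x y, pi (fun b => a * x b + y b) = a *: pi x + pi y.
Hypothesis jP : forall a m m' b, j (a *: m + m') b = a * j m b + j m' b.
Hypothesis nuP : forall a m m' b, nu (a *: m + m') b = a * nu m b + nu m' b.
Hypothesis nu_supp : forall m b, b \notin supp m -> nu m b = 0.
Hypothesis supp_uniq : forall m, uniq (supp m).
Hypothesis decomp : forall m, m = \sum_(b <- supp m) nu m b *: g b + pi (j m).
Hypothesis top : forall W, opM W <-> (forall m, W m ->
     exists S, forall x, vanish S x -> W (m + pi x)).
Hypothesis nuc : exists S, forall x, vanish S x -> forall b, nu (pi x) b = 0.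
Hypothesis jc : forall b, exists S, forall x, vanish S x -> j (pi x) b = 0.

Local Notation pw := (pw T Ti).

(** By [top], these submodules form a basis of neighbourhoods of [0]. *)
Definition small (S : seq B) (v : M) : Prop := exists x, vanish S x /\ v = pi x.

Lemma small_submod S : submod (small S).
Proof.
split=> [|a x y [x' [x0 ->]] [y' [y0 ->]]].
  by exists (fun=> 0); split=> //; rewrite (pi0 piP).
exists (fun b => a * x' b + y' b); rewrite piP; split=> // b bS.
by rewrite x0 // y0 // mulr0 addr0.
Qed.

(** Topological nilpotence speaks of lattices only; adding the line through [m] lets it control the
    orbit of a single vector. *)
Definition small_line (S : seq B) (m v : M) : Prop :=
  exists t w, small S w /\ v = t *: m + w.

(** An open submodule [U] contains [pi x] for all [x] vanishing on some finite [S1], so the quotient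
    by [U] is generated by [m] and the basis vectors at points of [S1] outside [S]. *)
Lemma small_line_lattice S m : lattice opM (small_line S m).
Proof.
have sub := small_submod S.
split; [split | split].
- by exists 0, 0; rewrite scale0r addr0; split=> //; apply: submod0.
- move=> a x y [t [w [Sw ->]]] [t' [w' [Sw' ->]]].
  exists (a * t + t'), (a *: w + w'); split; first by apply: (proj2 sub).
  by rewrite scalerDl scalerDr scalerA addrACA.
- apply/top => v [t [w [Sw ->]]]; exists S => x x0.
  exists t, (w + pi x); rewrite addrA; split=> //.
  by apply: (submodD sub) => //; exists x.
move=> U subU opU _; have [S1 HS1] := (proj1 (top U) opU) 0 (submod0 subU).
pose S2 := [seq b <- undup S1 | b \notin S].
have uS2 : uniq S2 by rewrite filter_uniq // undup_uniq.
exists (m :: [seq pi (indic R b) | b <- S2]); split.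
  move=> y; rewrite inE => /orP[/eqP-> | /mapP[b bS2 ->]].
    by exists 1, 0; rewrite scale1r addr0; split=> //; apply: submod0.
  exists 0, (pi (indic R b)); rewrite scale0r add0r; split=> //.
  exists (indic R b); split=> // c cS; rewrite /indic; case: eqP => // cb.
  by move: bS2; rewrite mem_filter -cb cS.
move=> y [t [_ [[x [x0 ->]] ->]]].
exists (fun k => nth 0 (t :: [seq x b | b <- S2]) k).
rewrite big_ord_recl /= opprD addrA [t *: m + _]addrC addrK.
have -> : \sum_(k < size [seq pi (indic R b) | b <- S2])
    nth 0 [seq x b | b <- S2] k *: nth 0 [seq pi (indic R b) | b <- S2] k =
    \sum_(b <- S2) x b *: pi (indic R b).
  elim: (S2) => [|b s IHs] /=; first by rewrite big_nil big_ord0.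
  by rewrite big_cons big_ord_recl IHs.
rewrite (pi_split piP x uS2) addrC addKr -[pi _]add0r; apply: HS1 => b bS1.
rewrite mem_filter mem_undup bS1 andbT; case: ifP => //= /negbFE; exact: x0.
Qed.

Lemma iter_small S m : exists N : nat, forall n, (N < n)%N -> forall x,
  small S (iter n T (pi x)) /\ small S (iter n T m).
Proof.
have [N HN] := Tnil (small_line_lattice S 0) (small_line_lattice [::] m).
have mem0 v : small_line S 0 v -> small S v.
  by case=> t [w [Sw ->]]; rewrite scaler0 add0r.
exists N => n ltn x; split; apply/mem0/HN => //.
  by exists 0, (pi x); rewrite scale0r add0r; split=> //; exists x.
exists 1, 0; rewrite scale1r addr0; split=> //.
exact: (submod0 (small_submod [::])).
Qed.

(* A [T]-stable lattice: [T^n] maps the image of [pi] into itself for large [n]. *)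
Definition Lsum (n : nat) (v : M) : Prop :=
  exists x : nat -> B -> R, v = \sum_(i < n.+1) pw i%:Z (pi (x i)).

Lemma Lsum_submod n : submod (Lsum n).
Proof.
split=> [|a x y [x' ->] [y' ->]].
  by exists (fun _ _ => 0); rewrite big1 // => i _; rewrite (pi0 piP) ?linear0.
exists (fun i b => a * x' i b + y' i b); rewrite scaler_sumr -big_split.
by apply: eq_bigr => i _ /=; rewrite piP linearP.
Qed.

Lemma Lsum_pi n x : Lsum n (pi x).
Proof.
exists (fun i => if i == 0%N then x else fun=> 0).
by rewrite big_ord_recl big1 ?addr0 // => i _; rewrite (pi0 piP) ?linear0.
Qed.

Lemma pw_continuous n : continuous_for opM opM (pw n).
Proof.
move=> V opV; case: n => n.
  elim: n V opV => // n IHn V opV.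
  exact: (IHn (fun x => V (T x)) (Tc opV)).
elim: n V opV => [|n IHn] V opV; first exact: Tic.
exact: (IHn (fun x => V (Ti x)) (Tic opV)).
Qed.

Section Stable.
Variable n0 : nat.
Hypothesis n0P : forall x, small [::] (iter n0.+1 T (pi x)).
Local Notation L := (Lsum n0).
Local Notation Lam := (Lam T Ti L).
Let subL : submod L := Lsum_submod n0.
Let subLam n : submod (Lam n) := Lam_submod T Ti subL n.
Let LamP := Lam_pw TK TiK L.

(** The last summand, moved to exponent [n0 + 1], falls back into the image of [pi] and becomes the
    summand of index [0]. *)
Lemma Lsum_stable v : L v -> L (T v).
Proof.
case=> x ->; have [y [_ yE]] := n0P (x n0).
exists (fun i => if i is i'.+1 then x i' else y).
rewrite linear_sum big_ord_recr big_ord_recl /= addrC; congr (_ + _).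
exact: yE.
Qed.
Let LamW := Lam_le TK TiK Lsum_stable.

Lemma Lsum_absorb m : exists n : nat, L (iter n T m).
Proof.
have [N HN] := iter_small [::] m; exists N.+1.
have [_ [x [_ ->]]] := HN N.+1 (ltnSn N) (fun=> 0); exact: Lsum_pi.
Qed.

(** An element of [T^N L] is a sum of terms [T^(N+i) pi (x i)], and high powers of [T] send the
    whole image of [pi] into [small S]. *)
Lemma Lam_small S : exists N : nat, forall v, Lam N%:Z v -> small S v.
Proof.
have [N HN] := iter_small S 0; exists N.+1 => v [x vE].
rewrite -(pwNK TK TiK N.+1%:Z v) {}vE linear_sum.
apply: (submod_sum (small_submod S)) => i _ /=.
rewrite -(pwD TK TiK).
by apply: (proj1 (HN (N.+1 + i)%N _ _)); rewrite ?leq_addr.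
Qed.

Lemma Lam_open n : opM (Lam n).
Proof.
apply: (@pw_continuous (- n) L); apply/top => m Lm; exists [::] => x _.
by apply: (submodD subL) => //; apply: Lsum_pi.
Qed.

Lemma small_Lam n : exists S, forall x, vanish S x -> Lam n (pi x).
Proof.
have [S HS] := proj1 (top _) (Lam_open n) 0 (submod0 (subLam n)).
by exists S => x /HS; rewrite add0r.
Qed.

(** The submodules [T^n L] and [small S] are cofinal in each other. *)
Lemma Lam_top W : opM W <->
  (forall m, W m -> exists N, forall v, Lam N v -> W (m + v)).
Proof.
split=> [/top opW m /opW[S HS] | HW].
  have [N HN] := Lam_small S; exists N%:Z => v /HN[x [x0 ->]]; exact: HS.
apply/top => m /HW[N HN]; have [S HS] := small_Lam N.
by exists S => x /HS; apply: HN.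
Qed.

(** Modulo [T^n L] only the finitely many coordinates in [S] of each [x i] matter. *)
Lemma Lsum_fg n : exists us : seq M, forall m, L m -> exists c : nat -> R,
  Lam n (m - \sum_(k < size us) c k *: nth 0 us k).
Proof.
have [S HS] := small_Lam n.
pose us := [seq pw i%:Z (pi (indic R b)) | i <- iota 0 n0.+1, b <- undup S].
exists us => _ [x ->].
suff [w [c wE] Hw] : exists2 w, span us w &
    Lam n (\sum_(i < n0.+1) pw i%:Z (pi (x i)) - w).
  by exists c; rewrite -wE.
exists (\sum_(i < n0.+1) \sum_(b <- undup S) x i b *: pw i%:Z (pi (indic R b))).
  apply: (submod_sum (span_submod us)) => i _.
  rewrite big_seq; apply: (submod_sum (span_submod us)) => b bS.
  apply: (submodZ (span_submod us)); apply: span_mem.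
  by apply: (allpairs_f (fun (i : nat) b => pw i%:Z (pi (indic R b)))) => //;
     rewrite mem_iota add0n ltn_ord.
rewrite -sumrB; apply: (submod_sum (subLam n)) => i _.
under eq_bigr do rewrite -linearZ.
rewrite -linear_sum -linearB (pi_split piP (x i) (undup_uniq S)) addrC addKr.
apply: (@LamW _ (i%:Z + n)); first by lia.
by rewrite LamP; apply: HS => b bS; rewrite mem_undup bS.
Qed.

Lemma nu_Lam : exists N : nat, forall m, Lam N%:Z m -> forall b, nu m b = 0.
Proof.
have [S HS] := nuc; have [N HN] := Lam_small S.
by exists N => m /HN[x [/HS x0 ->]].
Qed.

Lemma nu_sum b I (q : seq I) (F : I -> M) :
  nu (\sum_(i <- q) F i) b = \sum_(i <- q) nu (F i) b.
Proof.
apply: (big_morph (nu^~ b)) => [x y|].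
  by have := nuP 1 x y b; rewrite scale1r mul1r.
by have := nuP (-1) 0 0 b; rewrite scaleN1r oppr0 addr0 mulN1r addNr.
Qed.

(** [nu] vanishes on some [T^N L], and [L] is finitely generated modulo it, so the supports of the
    generators cover everything. *)
Lemma nu_finite : exists2 SP : seq B', uniq SP &
  forall y, L y -> forall b, b \notin SP -> nu y b = 0.
Proof.
have [N HN] := nu_Lam; have [us Hus] := Lsum_fg N%:Z.
exists (undup (flatten (map supp us))); first exact: undup_uniq.
move=> y /Hus[c Hc] b bS; rewrite -(subrK (\sum_(k < size us) c k *: nth 0 us k) y).
have := nuP 1 (y - \sum_(k < size us) c k *: nth 0 us k)
                (\sum_(k < size us) c k *: nth 0 us k) b.
rewrite scale1r => ->; rewrite HN // mulr0 add0r nu_sum big1 // => k _.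
have nu0 : nu 0 b = 0.
  by have := nuP (-1) 0 0 b; rewrite scaleN1r oppr0 addr0 mulN1r addNr.
rewrite -[_ *: _]addr0 nuP nu0 addr0 nu_supp ?mulr0 //.
apply: contra bS => bs; rewrite mem_undup; apply/flattenP.
by exists (supp (nth 0 us k)) => //; apply/map_f/mem_nth.
Qed.

Lemma stable_main : (exists s, lt_structure opM T s) /\
  (forall s, lt_structure opM T s -> fg_projective s /\ standard_topology opM s).
Proof.
have [SP uSP HSP] := nu_finite; have [N HN] := nu_Lam.
(* Dropping the free part of [decomp] gives a map into the image of [pi], inside [L], that is the
   identity where [nu] vanishes. *)
pose th0 m := pi (j m).
have th0_lin : linear th0.
  by move=> a x y; rewrite -piP; congr pi; apply/funext => b; apply: jP.
pose th : {linear M -> M} := HB.pack th0 (GRing.isLinear.Build R M M _ th0 th0_lin).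
have thid m : Lam N%:Z m -> th m = m.
  move=> /HN nu0; rewrite [RHS]decomp big1 ?add0r // => b _.
  by rewrite nu0 scale0r.
(* [L] may exceed the image of [pi], but its free coordinates lie in the finite set [SP]; adjoining
   them to the product makes [pi2] a left inverse of [j2] on [L]. *)
pose pi2 (x : B + B' -> R) := pi (fun b => x (inl b)) + \sum_(b <- SP) x (inr b) *: g b.
pose j2 m (b : B + B') := match b with inl b => j m b | inr b => nu m b end.
have pi2P a x y : pi2 (fun b => a * x b + y b) = a *: pi2 x + pi2 y.
  rewrite /pi2 piP scalerDr addrACA; congr (_ + _).
  rewrite scaler_sumr -big_split; apply: eq_bigr => b _ /=.
  by rewrite scalerDl scalerA.
have j2P a m m' b : j2 (a *: m + m') b = a * j2 m b + j2 m' b.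
  by case: b => b /=; rewrite ?jP ?nuP.
have pij y : L y -> pi2 (j2 y) = y.
  move=> Ly; rewrite [RHS]decomp addrC; congr (_ + _).
  apply: big_uniq_supp => // b bS; first by rewrite /= HSP ?scale0r.
  by rewrite /= nu_supp ?scale0r.
have pic n : exists S : seq (B + B'), forall x, (forall b, b \in S -> x b = 0) -> Lam n (pi2 x).
  have [S HS] := small_Lam n; exists (map inl S ++ map inr SP) => x x0.
  apply: (submodD (subLam n)).
    by apply: HS => b bS; apply: x0; rewrite mem_cat map_f.
  rewrite big_seq; apply: (submod_sum (subLam n)) => b bS.
  by rewrite x0 ?scale0r ?mem_cat ?map_f ?orbT //; apply: submod0.
have jc2 b : exists n : nat, forall m, Lam n%:Z m -> j2 m b = 0.
  case: b => b; last by exists N => m /HN/(_ b).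
  have [S HS] := jc b; have [n Hn] := Lam_small S.
  by exists n => m /Hn[x [/HS x0 ->]].
have sep := Lam_separated pi2P pij jc2.
have complete := Lam_complete TK TiK subL Lsum_stable pi2P pij pic jc2.
have thL m : L (th m) by apply: Lsum_pi.
have [us Hus] := Lsum_fg 1.
have [lam [u [n1 [e [lamP lam0 lamE]]]]] :=
  dual_basis_ex TK TiK subL Lsum_stable Lsum_absorb pi2P j2P pij pic Hus thL thid.
split.
  exact: (lt_structure_ex TK TiK subL Lsum_stable Lsum_absorb sep complete Lam_top).
move=> s lts; split.
  exact: (lt_structure_fg_projective TK TiK subL Lsum_stable Lsum_absorb sep Lam_top
    lamP lam0 lamE lts).
exact (lt_structure_standard_topology TK TiK subL Lsum_stable Lsum_absorb sep Lam_top
  lam0 lamE lts).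
Qed.

End Stable.
End LatticeConstruction.

Theorem theorem3p10 (R : comPzRingType) (M : lmodType R)
  (opM : (M -> Prop) -> Prop) (T : M -> M) :
  tate_module opM -> tate_automorphism opM T -> top_nilpotent opM T ->
  (exists s : lseries R -> M -> M, lt_structure opM T s) /\
  (forall s : lseries R -> M -> M, lt_structure opM T s ->
     fg_projective s /\ standard_topology opM s).
Proof.
move=> tateM [Tlin [Tc [Ti [Tilin [Tic [TiK TK]]]]]] Tnil.
pose Tl : {linear M -> M} := HB.pack T (GRing.isLinear.Build R M M _ T Tlin).
pose Til : {linear M -> M} := HB.pack Ti (GRing.isLinear.Build R M M _ Ti Tilin).
have [B [B' [pi [j [nu [supp [g [[piP [jP nuP]] [[nus [us dec]] [top [nuc jc]]]]]]]]]]] :=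
  tate_coordinates tateM.
(* With [S] empty, [small S] is the whole image of [pi]: every power of [T] beyond [N] maps it into
   itself, so [N] can serve as [n0]. *)
have [N HN] := @iter_small R M opM Tl Tnil B pi piP top [::] 0.
exact: (@stable_main R M opM Tl Til TK TiK Tc Tic Tnil B B' pi j nu supp g piP jP nuP
  nus us dec top nuc jc N (fun x => proj1 (HN N.+1 (ltnSn N) x))).
Qed.
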